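(* Let $I\subset S=\Bbbk[x_1,\dots,x_n]$ be a $d$-generated Borel fixed ideal. Then the lcm-lattice $L_I$ of $I$ is ranked.
   Context: $\Bbbk$ is a field with $\operatorname{char}(\Bbbk)=0$. For a monomial ideal $I$, $G(I)$ denotes its unique minimal set of monomial generators. A monomial ideal $I$ is Borel fixed if for every $\mathbf m\in G(I)$, every $x_t$ dividing $\mathbf m$ and every $1\le s<t$, the monomial $\frac{\mathbf m}{x_t}x_s$ is in $I$. It is $d$-generated if all elements of $G(I)$ have the same degree $d$. For a monomial ideal $I$ with $G(I)=\{\mathbf m_1,\dots,\mathbf m_r\}$, the lcm-lattice $L_I$ is the set of all least common multiples of subsets of $\{\mathbf m_1,\dots,\mathbf m_r\}$, ordered by divisibility, with bottom element $\hat 0=1$ (the lcm of the empty set) and top element $\hat 1=\operatorname{lcm}(\mathbf m_1,\dots,\mathbf m_r)$. A finite lattice is ranked if for any two comparable elements all maximal chains between them have the same length (equivalently, it admits a rank function increasing by exactly $1$ along each cover relation). *)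

(* Defs.v *)
From HB Require Import structures.
From mathcomp Require Import all_boot all_order all_algebra.
From mathcomp Require Export finmap.
From mathcomp Require Export mpoly.

Set Implicit Arguments.
Unset Strict Implicit.
Unset Printing Implicit Defensive.

Import GRing.Theory.
Local Open Scope ring_scope.
Local Open Scope fset_scope.

(* The order on a finite poset is an explicit relation [le], because the
   canonical order of 'X_{1..n} is degrevlex rather than divisibility. *)
Section Ranked.
Variables (T : choiceType) (le : rel T) (L : {fset T}).

Definition is_chain (a b : T) (C : {fset T}) : Prop :=
  [/\ C `<=` L,
      forall x, x \in C -> le a x && le x b
    & forall x y, x \in C -> y \in C -> le x y || le y x].

Definition is_max_chain (a b : T) (C : {fset T}) : Prop :=
  is_chain a b C /\ forall D, is_chain a b D -> C `<=` D -> D = C.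

(* The length of a finite chain C is #|` C| - 1, so chains between fixed
   comparable elements have the same length iff they have the same size. *)
Definition ranked : Prop :=
  forall a b, a \in L -> b \in L -> le a b ->
  forall C D, is_max_chain a b C -> is_max_chain a b D -> #|` C| = #|` D|.

End Ranked.

Section MonomialIdeals.
Variables (k : fieldType) (n : nat).
Implicit Types (I : {mpoly k[n]} -> Prop) (G : {fset 'X_{1..n}}).

Definition generated_by I G : Prop :=
  forall p, I p <-> exists c : 'X_{1..n} -> {mpoly k[n]},
                      p = \sum_(m <- G) c m * 'X_[m].

(* "I is a monomial ideal and G = G(I)". Minimal monomial generating sets are
   finite since the polynomial ring is Noetherian. *)
Definition minimal_monomial_generators I G : Prop :=
  generated_by I G /\ forall H, H `<=` G -> generated_by I H -> H = G.

(* If x_t divides m, then (m - U_(t) + U_(s))%MM is the exponent of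
   (m / x_t) * x_s: the truncated subtraction is exact. *)
Definition Borel_fixed I G : Prop :=
  forall m, m \in G -> forall t s : 'I_n,
    (0 < m t)%N -> (s < t)%N -> I 'X_[(m - U_(t) + U_(s))%MM].

Definition d_generated (d : nat) G : Prop :=
  forall m, m \in G -> mdeg m = d.

End MonomialIdeals.

Definition mdvd (n : nat) : rel 'X_{1..n} := fun u v => (u <= v)%MM.

Definition lcm_of (n : nat) (A : {fset 'X_{1..n}}) : 'X_{1..n} :=
  \big[@mlcm n/0%MM]_(m <- A) m.

Definition lcm_lattice (n : nat) (G : {fset 'X_{1..n}}) : {fset 'X_{1..n}} :=
  [fset lcm_of A | A in fpowerset G].

(* Main.v *)
Require Import Defs.
From mathcomp Require Import all_boot all_order all_algebra.
From mathcomp Require Import zify.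
Import GRing.Theory.
Local Open Scope ring_scope.

(** The rank function is explicit: [1] has rank [0], and every other element
    [u] of the lattice has rank [mdeg u - d + 1].  It is strictly increasing,
    and a finite order with a strictly increasing [rho] is ranked as soon as
    every relation [a < b] can be refined to [a < c <= b] with
    [rho c = rho a + 1]: then the values of [rho] along a maximal chain from
    [a] to [b] have no gaps, so the chain has [rho b - rho a + 1] elements
    ([ranked_of_unit_steps]).

    The existence of unit steps is where stability under Borel moves
    [m |-> m / x_t * x_s], [s < t], comes in.  Steps above [1] are given by the
    generators, all of degree [d].  Above [a != 1], choose generators [g]
    dividing [a] and [m] dividing [b] but not [a]; we look for a variable [x_s]
    with [a * x_s] in the lattice and dividing [b] ([lcm_lattice_step]).
    Let [x_s] be a variable with exponent larger in [m] than in [a].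
    - If some earlier variable [x_j] has exponent smaller in [m] than in [a],
      the generator [m / x_s * x_j] still divides [b] and is closer to dividing
      [a].  Either it divides [a], and then [lcm a m = a * x_s], or it replaces
      [m].
    - Otherwise [a], hence [g], has exponents at most those of [m] in the
      variables up to [x_s].  Since [g] and [m] have the same degree, [g]
      involves a variable beyond [x_s].  So one can trade later variables of [g]
      for [x_s] until the exponent of [x_s] in [g] is one more than in [a], and
      then [lcm a g = a * x_s] ([lcm_lattice_raise]). *)

(** * Ranked orders from a rank function with unit steps *)

Section UnitSteps.
Local Open Scope fset_scope.
Local Open Scope nat_scope.
Variables (T : choiceType) (le : rel T) (L : {fset T}) (rho : T -> nat).
Hypothesis le_refl : reflexive le.
Hypothesis le_trans : transitive le.
Hypothesis rho_lt : {in L &, forall x y, le x y -> x != y -> rho x < rho y}.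
Hypothesis unit_step : forall a b, a \in L -> b \in L -> le a b -> a != b ->
  exists c, [/\ c \in L, le a c, le c b & rho c = (rho a).+1].

Lemma mem_max_chain (a b : T) (C : {fset T}) (c : T) :
  is_max_chain le L a b C -> c \in L -> le a c -> le c b ->
  (forall z, z \in C -> le c z || le z c) -> c \in C.
Proof.
move=> [[sCL bC tC] maxC] cL ac cb cC.
suff <- : c |` C = C by exact: fset1U1.
apply: maxC; last exact: fsubsetU1.
split=> [|x|x y].
- by apply/fsubsetP=> x /fset1UP[->//|]; apply/fsubsetP.
- by case/fset1UP=> [->|/bC//]; rewrite ac cb.
- case/fset1UP=> [->|xC] /fset1UP[->|yC]; rewrite ?le_refl ?cC //.
    by rewrite orbC cC.
  exact: tC.
Qed.

(** If [y] is the next element of the chain after [x], a unit step from [x]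
    towards [y] is comparable with the whole chain, hence lies in it. *)
Lemma max_chain_next (a b : T) (C : {fset T}) (x : T) :
  is_max_chain le L a b C -> b \in C -> x \in C -> x != b ->
  exists2 c, c \in C & rho c = (rho x).+1.
Proof.
move=> maxC bC xC nxb; have [[/fsubsetP sCL endC totC] _] := maxC.
have xb : le x b by case/andP: (endC x xC).
pose P r := has (fun z => [&& le x z, x != z & rho z == r]) C.
have exP : exists r, P r.
  by exists (rho b); apply/hasP; exists b; rewrite ?xb ?nxb ?eqxx.
case: (ex_minnP exP) => r /hasP[y yC /and3P[xy nxy /eqP <-]] min_y.
have [c [cL xc cy rc]] := unit_step x y (sCL x xC) (sCL y yC) xy nxy.
exists c => //; apply: mem_max_chain maxC cL _ _ _.
- by apply: le_trans xc; case/andP: (endC x xC).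
- by apply: le_trans cy _; case/andP: (endC y yC).
move=> z zC; have [zx|nzx] := boolP (le z x).
  by rewrite (le_trans _ _ _ zx xc) orbT.
have xz : le x z by have := totC z x zC xC; rewrite (negPf nzx).
have nxz : x != z by apply: contraNneq nzx => ->.
have yz : le y z.
  have rho_yz : rho y <= rho z.
    by apply: min_y; apply/hasP; exists z; rewrite ?xz ?nxz ?eqxx.
  have [->//|nzy] := eqVneq z y.
  have /orP[//|zy] := totC y z yC zC.
  by have := rho_lt z y (sCL z zC) (sCL y yC) zy nzy; rewrite ltnNge rho_yz.
by rewrite (le_trans _ _ _ cy yz).
Qed.

Lemma card_max_chain (a b : T) (C : {fset T}) :
  a \in L -> b \in L -> le a b -> is_max_chain le L a b C ->
  #|` C| = (rho b - rho a).+1.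
Proof.
move=> aL bL ab maxC; have [[/fsubsetP sCL endC totC] _] := maxC.
have aC : a \in C.
  apply: mem_max_chain maxC aL _ ab _ => // z zC.
  by case/andP: (endC z zC) => ->.
have bC : b \in C.
  apply: mem_max_chain maxC bL ab _ _ => // z zC.
  by case/andP: (endC z zC) => _ ->; rewrite orbT.
have rho_le x y : x \in C -> y \in C -> le x y -> rho x <= rho y.
  move=> xC yC xy; have [->//|nxy] := eqVneq x y.
  by apply/ltnW/rho_lt => //; apply: sCL.
have rho_inj : {in C &, injective rho}.
  move=> x y xC yC rxy; apply/eqP; apply: contraPT rxy => nxy.
  case/orP: (totC x y xC yC) => le_xy.
    by have := rho_lt x y (sCL x xC) (sCL y yC) le_xy nxy; lia.
  by rewrite eq_sym in nxy;
    have := rho_lt y x (sCL y yC) (sCL x xC) le_xy nxy; lia.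
have no_gap r : r <= rho b - rho a -> exists2 x, x \in C & rho x = rho a + r.
  elim: r => [|r IHr] r_le; first by exists a; rewrite ?addn0.
  have [x xC rx] := IHr (ltnW r_le).
  have nxb : x != b by apply: contraTneq r_le => xb; rewrite xb in rx; lia.
  have [c cC rc] := max_chain_next a b C x maxC bC xC nxb.
  by exists c => //; rewrite rc rx addnS.
have -> : #|` C| = size [seq rho x | x <- C] by rewrite size_map.
rewrite -(size_iota (rho a) (rho b - rho a).+1).
apply/perm_size/uniq_perm; rewrite ?iota_uniq ?map_inj_in_uniq //.
move=> r; rewrite mem_iota; apply/mapP/idP => [[x xC ->]|r_in].
  case/andP: (endC x xC) => ax xb.
  by have := rho_le a x aC xC ax; have := rho_le x b xC bC xb; lia.
have [|x xC rx] := no_gap (r - rho a); first lia.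
by exists x => //; rewrite rx; lia.
Qed.

Lemma ranked_of_unit_steps : ranked le L.
Proof.
move=> a b aL bL ab C D maxC maxD.
by rewrite (card_max_chain a b C) // (card_max_chain a b D).
Qed.

End UnitSteps.

(** * Monomials and least common multiples *)

Section Lcm.
Variable n : nat.
Implicit Types (A G : {fset 'X_{1..n}}) (u v a b g m : 'X_{1..n}).
Local Open Scope fset_scope.
Local Open Scope nat_scope.

Lemma mdvd_anti : antisymmetric (@mdvd n).
Proof.
move=> u v /andP[/mnm_lepP uv /mnm_lepP vu]; apply/mnmP => i.
by apply/eqP; rewrite eqn_leq uv vu.
Qed.

Lemma mdvd_trans : transitive (@mdvd n).
Proof. by move=> v u w; apply: lepm_trans. Qed.

Lemma mdeg_lt_mdvd u v : (u <= v)%MM -> u != v -> mdeg u < mdeg v.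
Proof.
move=> uv; apply: contraNltn; rewrite -{1}(submK uv) mdegD => le_deg.
have /eqP d0 : (v - u)%MM == 0%MM by rewrite -mdeg_eq0; lia.
by rewrite -[v](submK uv) d0 add0m.
Qed.

Lemma mdvd_eq_mdeg u v : (u <= v)%MM -> mdeg u = mdeg v -> u = v.
Proof.
move=> uv deq; apply/eqP; apply: contraPT deq => nuv.
by have := mdeg_lt_mdvd u v uv nuv; lia.
Qed.

Lemma mdvdNP u v : ~~ (u <= v)%MM -> exists i, v i < u i.
Proof.
move=> nuv; apply/existsP; apply: contraNT nuv => /existsPn nlt.
by apply/mnm_lepP => i; rewrite leqNgt.
Qed.

Lemma lcm_of_mdvd A u : (lcm_of A <= u)%MM <-> {in A, forall m, (m <= u)%MM}.
Proof.
rewrite /lcm_of; have -> : (\big[@mlcm n/0%MM]_(m <- A) m <= u)%MM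
    = all (fun m => (m <= u)%MM) A.
  elim: (enum_fset A) => [|m s IHs] /=.
    by rewrite big_nil; apply/mnm_lepP => i; rewrite mnm0E.
  by rewrite big_cons lem_mlcm IHs.
by split=> /allP.
Qed.

Lemma mem_lcm_of A m : m \in A -> (m <= lcm_of A)%MM.
Proof. by move=> mA; apply: (proj1 (lcm_of_mdvd A _)); rewrite ?lepm_refl. Qed.

Lemma lcm_latticeP G u :
  reflect (exists2 A, A `<=` G & u = lcm_of A) (u \in lcm_lattice G).
Proof.
rewrite /lcm_lattice; apply: (iffP (imfsetP _ _ _ _)) => [[A /=]|[A sAG ->]].
  by rewrite fpowersetE => sAG ->; exists A.
by exists A; rewrite //= fpowersetE.
Qed.

Lemma lcm_lattice0 G : 0%MM \in lcm_lattice G.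
Proof.
apply/lcm_latticeP; exists fset0; rewrite ?fsub0set //.
apply: mdvd_anti; apply/andP; split; rewrite /mdvd.
  by apply/mnm_lepP => i; rewrite mnm0E.
by apply/lcm_of_mdvd => m; rewrite in_fset0.
Qed.

Lemma lcm_lattice_mlcm G a g :
  a \in lcm_lattice G -> g \in G -> mlcm a g \in lcm_lattice G.
Proof.
case/lcm_latticeP => A /fsubsetP sAG -> gG.
apply/lcm_latticeP; exists (g |` A).
  by apply/fsubsetP => m /fset1UP[->//|/sAG].
apply: mdvd_anti; apply/andP; split; rewrite /mdvd.
  rewrite lem_mlcm (mem_lcm_of _ g) ?fset1U1 // andbT.
  by apply/lcm_of_mdvd => m mA; apply: mem_lcm_of; rewrite fset1Ur.
apply/lcm_of_mdvd => m /fset1UP[->|mA]; first exact: lem_mlcmr.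
exact: lepm_trans (mem_lcm_of A m mA) (lem_mlcml _ _).
Qed.

Lemma generator_lcm_lattice G g : g \in G -> g \in lcm_lattice G.
Proof.
by move=> gG; rewrite -(mlc0m g) lcm_lattice_mlcm // lcm_lattice0.
Qed.

Lemma lcm_lattice_mdvdNP G b u : b \in lcm_lattice G -> ~~ (b <= u)%MM ->
  exists2 m, m \in G & (m <= b)%MM && ~~ (m <= u)%MM.
Proof.
case/lcm_latticeP => A /fsubsetP sAG -> nbu.
have /allPn[m mA nmu] : ~~ all (fun m => (m <= u)%MM) A.
  by apply: contraNN nbu => /allP Au; apply/lcm_of_mdvd.
by exists m; rewrite ?sAG // mem_lcm_of.
Qed.

End Lcm.

(** * Unit steps in the lcm-lattice of a Borel-stable set *)

Section Borel.
Variables (n d : nat) (G : {fset 'X_{1..n}}).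
Implicit Types (u v a b g m : 'X_{1..n}) (s t : 'I_n).
Local Open Scope fset_scope.
Local Open Scope nat_scope.
Hypothesis borelG : forall m, m \in G -> forall t s,
  0 < m t -> s < t -> (m - U_(t) + U_(s))%MM \in G.
Hypothesis degG : d_generated d G.

Lemma borel_moveE m t s i :
  (m - U_(t) + U_(s))%MM i = m i - (t == i) + (s == i).
Proof. by rewrite mnmDE mnmBE !mnm1E. Qed.

(** Up to [x_s] the exponents of [g] are at most those of [a], hence of [m];
    as [g] and [m] have the same degree, [g] involves a variable beyond [x_s],
    which can be traded for [x_s].  Repeating this raises the exponent of [x_s]
    in [g] past the one in [a]. *)
Lemma lcm_lattice_raise a g m s : a \in lcm_lattice G ->
  g \in G -> (g <= a)%MM -> m \in G ->
  (forall j : 'I_n, j < s -> a j <= m j) -> a s < m s ->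
  (a + U_(s))%MM \in lcm_lattice G.
Proof.
move=> aL + + mG a_le a_lt.
have [k] := ubnP (a s - g s); elim: k g => // k IHk g le_k gG /mnm_lepP ga.
have [t lt_st gt] : exists2 t : 'I_n, s < t & 0 < g t.
  apply/exists_inP; apply: contraPT (degG g gG) => /exists_inPn g0.
  rewrite -(degG m mG) => deg_gm.
  suff gm : (g <= m)%MM.
    by have := ga s; rewrite (mdvd_eq_mdeg _ _ _ gm deg_gm); lia.
  apply/mnm_lepP => j; case: (ltngtP j s) => [js|sj|/ord_inj ->].
  - exact: leq_trans (ga j) (a_le j js).
  - by have := g0 j sj; rewrite -leqNgt leqn0 => /eqP->.
  - exact: leq_trans (ga s) (ltnW a_lt).
have nts : (t == s) = false by apply: contraTF lt_st => /eqP->; rewrite ltnn.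
have g'G := borelG g gG t s gt lt_st.
have [gs|gs] := ltnP (g s) (a s).
  apply: IHk g'G _; first by rewrite borel_moveE nts eqxx; lia.
  apply/mnm_lepP => i; rewrite borel_moveE; have := ga i.
  by case: (s =P i) => [<-|_]; lia.
suff -> : (a + U_(s) = mlcm a (g - U_(t) + U_(s)))%MM.
  exact: lcm_lattice_mlcm.
apply/mnmP => i; rewrite mnmDE mnm1E mnmE borel_moveE; have := ga i.
by case: (s =P i) => [<-|_]; rewrite ?nts; lia.
Qed.

(** Induction on the degree of [m / gcd m a]: as long as some variable before
    [x_s] is deficient in [m], moving an excess [x_s] there brings [m] closer to
    dividing [a]; otherwise [lcm_lattice_raise] applies. *)
Lemma lcm_lattice_step a g m : a \in lcm_lattice G ->
  g \in G -> (g <= a)%MM -> m \in G -> ~~ (m <= a)%MM ->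
  exists2 s, a s < m s & (a + U_(s))%MM \in lcm_lattice G.
Proof.
move=> aL gG ga; have [k] := ubnP (mdeg (m - a)%MM).
elim: k m => // k IHk m le_k mG nma; have [s as_lt] := mdvdNP _ _ _ nma.
have [/exists_inP[j js mj]|/exists_inPn noj] :=
    boolP [exists (j : 'I_n | j < s), m j < a j]; last first.
  exists s => //; apply: lcm_lattice_raise aL gG ga mG _ as_lt => j js.
  by rewrite leqNgt; apply: noj.
have nsj : (s == j) = false by apply: contraTF js => /eqP->; rewrite ltnn.
have m'G : (m - U_(s) + U_(j))%MM \in G by apply: borelG => //; lia.
have [/mnm_lepP m'a|nm'a] := boolP (m - U_(s) + U_(j) <= a)%MM.
  exists s => //; suff -> : (a + U_(s) = mlcm a m)%MM.
    exact: lcm_lattice_mlcm.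
  apply/mnmP => i; rewrite mnmDE mnm1E mnmE; have := m'a i.
  rewrite borel_moveE; case: (s =P i) => [<-|_]; last lia.
  by rewrite eq_sym nsj; lia.
have closer : mdeg (m - U_(s) + U_(j) - a)%MM < mdeg (m - a)%MM.
  apply: mdeg_lt_mdvd.
    apply/mnm_lepP => i; rewrite !mnmBE borel_moveE.
    by case: (j =P i) => [<-|_]; lia.
  apply/eqP => /mnmP/(_ s); rewrite !mnmBE borel_moveE eqxx eq_sym nsj; lia.
have [|s' as'_lt s'L] := IHk _ _ m'G nm'a; first lia.
exists s' => //; move: as'_lt; rewrite borel_moveE.
by case: (j =P s') => [<-|_]; lia.
Qed.

Definition lcm_rank u : nat := if u == 0%MM then 0 else (mdeg u - d).+1.

Lemma lcm_lattice_generator b : b \in lcm_lattice G -> b != 0%MM ->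
  exists2 g, g \in G & (g <= b)%MM.
Proof.
move=> bL nb0; have [|g gG /andP[gb _]] := @lcm_lattice_mdvdNP n G b 0%MM bL.
  by apply: contraNN nb0 => b0; apply/eqP/mnmP => i;
     have /mnm_lepP/(_ i) := b0; rewrite mnm0E; lia.
by exists g.
Qed.

Lemma mdeg_lcm_lattice b : b \in lcm_lattice G -> b != 0%MM -> d <= mdeg b.
Proof.
move=> bL nb0; have [g gG gb] := lcm_lattice_generator b bL nb0.
by rewrite -(submK gb) mdegD (degG g gG) leq_addl.
Qed.

Lemma lcm_rank_lt : {in lcm_lattice G &, forall u v,
  mdvd u v -> u != v -> lcm_rank u < lcm_rank v}.
Proof.
move=> u v uL vL uv nuv; have deg_uv := mdeg_lt_mdvd _ _ _ uv nuv.
have nv0 : v != 0%MM by rewrite -mdeg_eq0; lia.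
rewrite /lcm_rank (negPf nv0); case: eqVneq => // nu0.
by have := mdeg_lcm_lattice u uL nu0; lia.
Qed.

Lemma lcm_rank_step a b : a \in lcm_lattice G -> b \in lcm_lattice G ->
  mdvd a b -> a != b ->
  exists c, [/\ c \in lcm_lattice G, mdvd a c, mdvd c b
              & lcm_rank c = (lcm_rank a).+1].
Proof.
move=> aL bL ab nab; have nba : ~~ (b <= a)%MM.
  apply: contraNN nab => ba; apply/eqP/mdvd_anti.
  by rewrite ab.
have [m mG /andP[mb nma]] := lcm_lattice_mdvdNP _ _ _ _ bL nba.
have [a0|na0] := eqVneq a 0%MM.
  exists m; split=> //; first exact: generator_lcm_lattice.
    by rewrite a0; apply/mnm_lepP => i; rewrite mnm0E.
  have nm0 : m != 0%MM by apply: contraNneq nma => ->; rewrite a0 lepm_refl.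
  by rewrite /lcm_rank a0 eqxx (negPf nm0) (degG m mG) subnn.
have [g gG ga] := lcm_lattice_generator a aL na0.
have [s as_lt cL] := lcm_lattice_step a g m aL gG ga mG nma.
exists (a + U_(s))%MM; split=> //; first exact: lem_addr.
  apply/mnm_lepP => i; rewrite mnmDE mnm1E.
  have /mnm_lepP/(_ i) := ab; have /mnm_lepP/(_ i) := mb.
  by case: (s =P i) as_lt => [<-|_]; lia.
rewrite /lcm_rank (negPf na0) -mdeg_eq0 mdegD mdeg1 addn1 /=.
by rewrite subSn // mdeg_lcm_lattice.
Qed.

Lemma ranked_lcm_lattice : ranked (@mdvd n) (lcm_lattice G).
Proof.
apply: (ranked_of_unit_steps _ _ _ lcm_rank).
- exact: lepm_refl.
- exact: mdvd_trans.
- exact: lcm_rank_lt.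
- exact: lcm_rank_step.
Qed.

End Borel.

(** * Equigenerated Borel fixed ideals *)

Lemma mem_monomial_ideal (k : fieldType) (n : nat)
    (I : {mpoly k[n]} -> Prop) (G : {fset 'X_{1..n}}) (u : 'X_{1..n}) :
  generated_by I G -> I 'X_[u] -> exists2 m, m \in G & (m <= u)%MM.
Proof.
move=> genG /genG[c Xu]; have : u \in msupp ('X_[u] : {mpoly k[n]}).
  by rewrite msuppX inE.
rewrite {1}Xu => /msupp_sum_le/flattenP[s /mapP[m]].
rewrite mem_filter => /andP[_ mG] -> /=.
rewrite (perm_mem (msuppMX _ _)) => /mapP[v _ ->].
by exists m => //; apply: lem_addr.
Qed.

Theorem proposition4p3 (k : fieldType) (n d : nat)
    (I : {mpoly k[n]} -> Prop) (G : {fset 'X_{1..n}}) :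
  [pchar k] =i pred0 ->
  minimal_monomial_generators I G ->
  Borel_fixed I G ->
  d_generated d G ->
  ranked (@mdvd n) (lcm_lattice G).
Proof.
move=> _ [genG _] borelI degG; apply: (ranked_lcm_lattice n d) => //.
move=> m mG t s mt st.
(* A Borel move keeps the degree [d], so the generator dividing its result is
   that result. *)
have [g gG g_dvd] := mem_monomial_ideal _ _ _ _ _ genG (borelI m mG t s mt st).
suff <- : g = (m - U_(t) + U_(s))%MM by [].
have Ut : (U_(t) <= m)%MM.
  by apply/mnm_lepP => i; rewrite mnm1E; case: (t =P i) => [<-|].
apply: mdvd_eq_mdeg g_dvd _.
by rewrite mdegD mdeg1 (degG g gG) -(degG m mG) -{1}(submK Ut) mdegD mdeg1.
Qed.
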